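(* For every $n\ge 1$ and every permutation $\sigma\in\mathfrak{S}_n$, with image $\hat\sigma:=\Phi(\sigma)$, one has $$\bigl(\mathrm{lrmin}(\sigma),\mathbf{P_3}(\sigma),\mathbf{P_4}(\sigma),\mathbf{P_7}(\sigma),\mathbf{P_8}(\sigma)\bigr)=\bigl(\mathrm{lrmin}(\hat\sigma),\mathbf{P_4}(\hat\sigma),\mathbf{P_3}(\hat\sigma),\mathbf{P_8}(\hat\sigma),\mathbf{P_7}(\hat\sigma)\bigr).$$
   Context: $\mathfrak{S}_n$ is the set of permutations $\sigma=\sigma_1\sigma_2\cdots\sigma_n$ of $[n]=\{1,\dots,n\}$ in one-line notation. A mesh pattern is a pair $p=(\pi,R)$ with $\pi\in\mathfrak{S}_m$ and $R\subseteq\{0,\dots,m\}\times\{0,\dots,m\}$ (the set of shaded unit cells, each given by its bottom-left corner, in the grid with dots at $(i,\pi_i)$). An occurrence of $p$ in $\sigma\in\mathfrak{S}_n$ is a choice of indices $i_1<\cdots<i_m$ such that $\sigma_{i_1}\cdots\sigma_{i_m}$ is order-isomorphic to $\pi$ and, for every $(a,b)\in R$, there is no index $r$ with $i_a<r<i_{a+1}$ and $v_b<\sigma_r<v_{b+1}$; here $v_1<\cdots<v_m$ is the increasing rearrangement of $\sigma_{i_1},\dots,\sigma_{i_m}$, $i_0=v_0=0$ and $i_{m+1}=v_{m+1}=n+1$. The mesh patterns: $\mathrm{P}_3=(123,R)$ and $\mathrm{P}_4=(132,R)$ with $R=\{(0,0),(0,1),(2,0),(2,1),(2,3),(3,0),(3,1),(3,3)\}$;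 $\mathrm{P}_7=(123,R')$ and $\mathrm{P}_8=(132,R')$ with $R'=\{(1,0),(1,1),(2,0),(2,1),(2,3),(3,0),(3,1),(3,3)\}$. Refined statistics: for $i\in\{3,4,7,8\}$ and $k\ge0$, $\mathrm{P}_{i,k}(\sigma)$ is the number of triples of indices $a<b<c$ forming an occurrence $(\sigma_a,\sigma_b,\sigma_c)$ of $\mathrm{P}_i$ in $\sigma$ with $c-b=k+1$. The vector statistic is $\mathbf{P_i}(\sigma)=(\mathrm{P}_{i,0}(\sigma),\mathrm{P}_{i,1}(\sigma),\dots,\mathrm{P}_{i,n-3}(\sigma))$ (an empty vector if $n<3$). $\mathrm{lrmin}(\sigma)$ is the number of left-to-right minima of $\sigma$, i.e. entries $\sigma_i$ with $\sigma_i<\sigma_j$ for all $1\le j<i$. Complement of a sequence: for a sequence $\alpha=a_1\cdots a_m$ of distinct positive integers with increasing rearrangement $b_1<\cdots<b_m$, $\kappa(\alpha)=\hat a_1\cdots\hat a_m$ where $\hat a_i=b_{m+1-j}$ if $a_i=b_j$ (e.g. $\kappa(4189)=8941$; the empty sequence is mapped to itself). The map $\Phi:\mathfrak{S}_n\to\mathfrak{S}_n$: write $\sigma$ as the concatenation $\sigma=\sigma'\,1\,\sigma''$ (with $\sigma',\sigma''$ possibly empty); then $\Phi(\sigma)=\sigma'\,1\,\kappa(\sigma'')$. *)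

(* Defs.v *)
From mathcomp Require Import all_boot all_order all_fingroup.
Set Implicit Arguments.
Unset Strict Implicit.
Unset Printing Implicit Defensive.

(* ['S_n] acts on 'I_n = {0, ..., n-1}; the mathematical positions and values
   1, ..., n are the successors of these ordinals. *)
Definition oneline n (s : 'S_n) : seq nat := [seq (s i).+1 | i <- enum 'I_n].

(* Meaningful when [w] is a rearrangement of 1, ..., n; see [of_onelineK]. *)
Definition of_oneline n (w : seq nat) : 'S_n :=
  odflt (1%g : 'S_n) [pick s : 'S_n | oneline s == w].

Lemma of_onelineK n (w : seq nat) :
  perm_eq w (iota 1 n) -> oneline (of_oneline n w) = w.
Proof.
move=> w_perm; rewrite /of_oneline; case: pickP => [s /eqP //|noS].
have sz_w : size w = n by rewrite (perm_size w_perm) size_iota.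
have w_bnd (i : 'I_n) : (nth 0 w i).-1 < n.
  have : nth 0 w i \in iota 1 n by rewrite -(perm_mem w_perm) mem_nth ?sz_w.
  by rewrite mem_iota; case: (nth 0 w i).
have w_pos (i : 'I_n) : 0 < nth 0 w i.
  have : nth 0 w i \in iota 1 n by rewrite -(perm_mem w_perm) mem_nth ?sz_w.
  by rewrite mem_iota => /andP[].
have f_inj : injective (fun i : 'I_n => Ordinal (w_bnd i)).
  move=> i j /(congr1 val) /= eq_ij; apply/val_inj/eqP => /=.
  rewrite -(nth_uniq 0 (s := w)) ?sz_w //; last first.
    by rewrite (perm_uniq w_perm) iota_uniq.
  by rewrite -(prednK (w_pos i)) -(prednK (w_pos j)) eq_ij.
have /negP[] := negbT (noS (perm f_inj)); apply/eqP.
apply: (@eq_from_nth _ 0) => [|i].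
  by rewrite size_map size_enum_ord sz_w.
rewrite size_map size_enum_ord => i_n; have i0 := Ordinal i_n.
rewrite (nth_map i0) ?size_enum_ord // permE /= prednK ?nth_enum_ord //.
exact: w_pos (Ordinal i_n).
Qed.

Record mesh_pattern m := MeshPattern {
  mesh_perm : 'S_m;
  mesh_shade : {set 'I_m.+1 * 'I_m.+1}
}.

(* Adds the conventional boundary entries 0 (index 0) and n+1 (last index). *)
Definition bordered n (w : seq nat) : seq nat := 0 :: rcons w n.+1.

Definition occ_pos n m (t : m.-tuple 'I_n) : seq nat :=
  bordered n [seq (i : 'I_n).+1 | i <- t].

Definition occ_val n m (s : 'S_n) (t : m.-tuple 'I_n) : seq nat :=
  bordered n (sort leq [seq (s i).+1 | i <- t]).

Definition occurrence n m (p : mesh_pattern m) (s : 'S_n)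
    (t : m.-tuple 'I_n) : bool :=
  [&& [forall x : 'I_m, forall y : 'I_m,
         (x < y) ==> (tnth t x < tnth t y)],
      [forall x : 'I_m, forall y : 'I_m,
         (s (tnth t x) < s (tnth t y)) == (mesh_perm p x < mesh_perm p y)]
    & [forall ab in mesh_shade p, ~~ [exists r : 'I_n,
         (nth 0 (occ_pos t) ab.1 < r.+1 < nth 0 (occ_pos t) ab.1.+1) &&
         (nth 0 (occ_val s t) ab.2 < (s r).+1 < nth 0 (occ_val s t) ab.2.+1)]]].

Definition mesh3 (w : seq nat) (R : seq (nat * nat)) : mesh_pattern 3 :=
  MeshPattern (of_oneline 3 w)
    [set ab : 'I_4 * 'I_4 | (ab.1 : nat, ab.2 : nat) \in R].

Definition shade34 : seq (nat * nat) :=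
  [:: (0, 0); (0, 1); (2, 0); (2, 1); (2, 3); (3, 0); (3, 1); (3, 3)].

Definition shade78 : seq (nat * nat) :=
  [:: (1, 0); (1, 1); (2, 0); (2, 1); (2, 3); (3, 0); (3, 1); (3, 3)].

Definition P3 := mesh3 [:: 1; 2; 3] shade34.
Definition P4 := mesh3 [:: 1; 3; 2] shade34.
Definition P7 := mesh3 [:: 1; 2; 3] shade78.
Definition P8 := mesh3 [:: 1; 3; 2] shade78.

Definition refined_stat n (p : mesh_pattern 3) (k : nat) (s : 'S_n) : nat :=
  #|[set t : 3.-tuple 'I_n | occurrence p s t &&
      (tnth t (@Ordinal 3 2 isT) - tnth t (@Ordinal 3 1 isT) == k.+1)]|.

(* The n - 2 entries k = 0, ..., n - 3; truncated subtraction makes the vector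
   empty when n < 3. *)
Definition vector_stat n (p : mesh_pattern 3) (s : 'S_n) : seq nat :=
  mkseq (fun k => refined_stat p k s) (n - 2).

Definition lrmin n (s : 'S_n) : nat :=
  #|[set i : 'I_n | [forall j : 'I_n, (j < i) ==> (s i < s j)]]|.

(* With 0-based indices, the entry b_j is [nth 0 b j.-1], so b_(m+1-j) has
   index m - j where j = (index a b).+1. *)
Definition kappa (w : seq nat) : seq nat :=
  let b := sort leq w in
  [seq nth 0 b (size w - (index a b).+1) | a <- w].

Definition Phi_word (w : seq nat) : seq nat :=
  let i := index 1 w in take i w ++ 1 :: kappa (drop i.+1 w).

Definition Phi n (s : 'S_n) : 'S_n := of_oneline n (Phi_word (oneline s)).

Example kappa_4189 : kappa [:: 4; 1; 8; 9] = [:: 8; 9; 4; 1].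
Proof. by []. Qed.

Lemma perm_oneline n (s : 'S_n) : perm_eq (oneline s) (iota 1 n).
Proof.
have -> : oneline s = [seq x.+1 | x <- map val (map s (enum 'I_n))].
  by rewrite /oneline -!map_comp.
have -> : iota 1 n = [seq x.+1 | x <- map val (enum 'I_n)].
  by rewrite val_enum_ord -(iotaDl 1 0).
do 2 apply: perm_map; apply: uniq_perm.
- by rewrite (map_inj_uniq (@perm_inj _ s)) enum_uniq.
- exact: enum_uniq.
move=> x; rewrite mem_enum inE; apply/mapP.
by exists (s^-1%g x); rewrite ?mem_enum ?permKV.
Qed.

Lemma perm_kappa (w : seq nat) : uniq w -> perm_eq (kappa w) w.
Proof.
move=> w_uniq; rewrite /kappa; set b := sort leq w.
have b_perm : perm_eq b w by rewrite perm_sort.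
have b_uniq : uniq b by rewrite (perm_uniq b_perm).
rewrite -(perm_size b_perm) perm_sym -(permPl b_perm) perm_sym.
rewrite -(permPl (perm_map _ b_perm)).
suff -> : [seq nth 0 b (size b - (index a b).+1) | a <- b] = rev b.
  by rewrite perm_rev.
apply: (@eq_from_nth _ 0) => [|i]; rewrite size_map ?size_rev // => i_b.
by rewrite (nth_map 0) // index_uniq // nth_rev.
Qed.

Lemma oneline_Phi n (s : 'S_n) :
  0 < n -> oneline (Phi s) = Phi_word (oneline s).
Proof.
move=> n_gt0; apply: of_onelineK; set w := oneline s.
have w_perm : perm_eq w (iota 1 n) := perm_oneline s.
have w1 : 1 \in w by rewrite (perm_mem w_perm) mem_iota /= add1n ltnS.
have w_uniq : uniq w by rewrite (perm_uniq w_perm) iota_uniq.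
apply: perm_trans w_perm; rewrite /Phi_word.
rewrite -[X in perm_eq _ X](cat_take_drop (index 1 w)) perm_cat2l.
have -> : drop (index 1 w) w = 1 :: drop (index 1 w).+1 w.
  by rewrite (drop_nth 0) ?index_mem // nth_index.
rewrite perm_cons.
by rewrite perm_kappa // drop_uniq.
Qed.

Lemma oneline_P3_P7 : oneline (mesh_perm P3) = [:: 1; 2; 3] /\
  oneline (mesh_perm P7) = [:: 1; 2; 3].
Proof. by split; apply: of_onelineK. Qed.

Lemma oneline_P4_P8 : oneline (mesh_perm P4) = [:: 1; 3; 2] /\
  oneline (mesh_perm P8) = [:: 1; 3; 2].
Proof. by split; apply: of_onelineK. Qed.

(* Main.v *)
Require Import Defs.
From mathcomp Require Import all_boot all_order all_fingroup.
From mathcomp Require Import zify.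

Set Implicit Arguments.
Unset Strict Implicit.
Unset Printing Implicit Defensive.

(** In all four patterns the shading of columns 2 and 3 says that every entry
    to the right of the middle letter, other than the last letter, has a value
    strictly between those of these two letters.  So an occurrence at positions
    a < b < c makes the two last letters the extreme values of the suffix that
    starts at b: minimum first and maximum at c for the patterns on 123, the
    reverse for the patterns on 132.  Let v be the minimum of that suffix.  The
    remaining shading only says which entry below v plays the first letter: the
    leftmost one when column 0 is shaded, the rightmost one before b when
    column 1 is shaded.  In both cases such a position a is unique, and it
    exists as soon as some entry is below v, that is, as soon as the entry 1
    stands to the left of b.  Hence each refined statistic counts pairs (b, c)
    with b to the right of the entry 1 ([refined_stat_spans]), and the first
    letter disappears from the count.

    The map Phi fixes everything up to the entry 1 and reverses the relative
    order of the entries to its right ([Phi_prefix], [Phi_suffix]).  It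
    therefore exchanges minimum and maximum of each of the suffixes concerned,
    without moving b and c ([span_pairs_Phi]).  The left-to-right minima are all
    found in the part that Phi fixes. *)

(** * The complement of a word and the map Phi *)

(** The complement reverses ranks in the sorted word, and an entry is larger
    exactly when its rank is. *)
Lemma kappa_anti w i j : uniq w -> i < size w -> j < size w ->
  (nth 0 (kappa w) i < nth 0 (kappa w) j) = (nth 0 w j < nth 0 w i).
Proof.
move=> w_uniq lt_i lt_j; rewrite !(nth_map 0) //; set b := sort leq w.
have b_uniq : uniq b by rewrite sort_uniq.
have b_sorted : sorted ltn b.
  by rewrite ltn_sorted_uniq_leq b_uniq sort_sorted //; apply: leq_total.
have size_b : size b = size w by rewrite size_sort.
have b_homo := sorted_ltn_nth ltn_trans 0 b_sorted.
have b_mono : {in gtn (size b) &, {mono nth 0 b : k l / k < l}}.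
  move=> k l lt_k lt_l; have [|lt_lk|->] := ltngtP k l; last exact: ltnn.
    exact: b_homo.
  by apply/negbTE; rewrite -leqNgt ltnW // b_homo.
have idx k : k < size w -> (index (nth 0 w k) b < size b) /\
    nth 0 b (index (nth 0 w k) b) = nth 0 w k.
  by move=> lt_k; rewrite index_mem nth_index ?mem_sort ?mem_nth.
have [[lt_bi eq_bi] [lt_bj eq_bj]] := (idx i lt_i, idx j lt_j).
rewrite -[in RHS]eq_bi -[in RHS]eq_bj.
move: lt_bi lt_bj b_mono; rewrite size_b.
move: (index _ b) (index _ b) (size w) => ri rj m lt_ri lt_rj b_mono.
by rewrite !b_mono ?inE; lia.
Qed.

Lemma nth_oneline n (s : 'S_n) (i : 'I_n) : nth 0 (oneline s) i = (s i).+1.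
Proof. by rewrite (nth_map i) ?size_enum_ord // nth_ord_enum. Qed.

Lemma size_oneline n (s : 'S_n) : size (oneline s) = n.
Proof. by rewrite size_map size_enum_ord. Qed.

Lemma uniq_oneline n (s : 'S_n) : uniq (oneline s).
Proof. by rewrite (perm_uniq (perm_oneline s)) iota_uniq. Qed.

Lemma index1_oneline n (s : 'S_n) (p : 'I_n) :
  s p = 0 :> nat -> index 1 (oneline s) = p.
Proof.
move=> sp0; have <- : nth 0 (oneline s) p = 1 by rewrite nth_oneline sp0.
by rewrite index_uniq ?size_oneline ?uniq_oneline.
Qed.

Lemma nth_oneline_Phi n (s : 'S_n) (p i : 'I_n) : s p = 0 :> nat ->
  (Phi s i).+1 = nth 0 (take p (oneline s) ++
                        1 :: kappa (drop p.+1 (oneline s))) i.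
Proof.
move=> sp0; have n_gt0 : 0 < n by case: n {s sp0} p i => [[]|].
by rewrite -nth_oneline oneline_Phi // /Phi_word (index1_oneline sp0).
Qed.

Lemma Phi_prefix n (s : 'S_n) (p i : 'I_n) :
  s p = 0 :> nat -> i <= p -> Phi s i = s i.
Proof.
move=> sp0 le_ip; apply/val_inj/succn_inj => /=.
rewrite (nth_oneline_Phi _ sp0) nth_cat.
rewrite size_takel ?size_oneline ?(ltnW (ltn_ord p)) //.
move: le_ip; rewrite leq_eqVlt => /predU1P[/val_inj ->|lt_ip].
  by rewrite ltnn subnn sp0.
by rewrite lt_ip nth_take // nth_oneline.
Qed.

Lemma Phi_suffix n (s : 'S_n) (p i j : 'I_n) :
  s p = 0 :> nat -> p < i -> p < j -> (Phi s i < Phi s j) = (s j < s i).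
Proof.
move=> sp0 lt_pi lt_pj; set w := drop p.+1 (oneline s).
have size_w : size w = n - p.+1 by rewrite size_drop size_oneline.
have PhiE (k : 'I_n) : p < k -> (Phi s k).+1 = nth 0 (kappa w) (k - p.+1).
  move=> lt_pk; rewrite (nth_oneline_Phi _ sp0) nth_cat.
  rewrite size_takel ?size_oneline ?(ltnW (ltn_ord p)) // ltnNge ltnW //=.
  by rewrite subnS; case: (k - p) (subn_gt0 p k) => [|m]; rewrite ?lt_pk.
have sE (k : 'I_n) : p < k -> (s k).+1 = nth 0 w (k - p.+1).
  by move=> lt_pk; rewrite nth_drop subnKC // nth_oneline.
rewrite -ltnS PhiE // PhiE // kappa_anti ?drop_uniq ?uniq_oneline //.
- by rewrite -!sE.
- by rewrite size_w; have := ltn_ord i; lia.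
- by rewrite size_w; have := ltn_ord j; lia.
Qed.

(** Nothing to the right of the entry 1 is a left-to-right minimum. *)
Lemma lrmin_Phi n (s : 'S_n) (p : 'I_n) :
  s p = 0 :> nat -> lrmin (Phi s) = lrmin s.
Proof.
move=> sp0; apply: eq_card => i; rewrite !inE.
have [le_ip|lt_pi] := leqP i p.
  apply: eq_forallb => j; case: (ltnP j i) => //= lt_ji.
  by rewrite !(Phi_prefix sp0) // (leq_trans (ltnW lt_ji)).
have Phip := Phi_prefix sp0 (leqnn p).
by apply/forallP/forallP => /(_ p); rewrite lt_pi ?Phip sp0.
Qed.

(** * Pairs of positions spanning a suffix *)

(** For [lo] and [hi] both at least [b], this says that they are the positions
    of the minimum and of the maximum of the suffix that starts at [b].  The
    shading gives strict bounds away from the two positions themselves; the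
    weak form has no exceptions and is carried to itself, with [lo] and [hi]
    exchanged, when the order of the values is reversed. *)
Definition spans n (s : 'S_n) (b lo hi : 'I_n) : bool :=
  [forall r : 'I_n, (b <= r) ==> (s lo <= s r <= s hi)].

(** The flag [asc] tells the patterns on 123 from those on 132: it decides
    which of the two last letters of an occurrence is the lower one. *)
Definition span_pairs n (asc : bool) (k : nat) (p : 'I_n) (s : 'S_n) :
    {set 'I_n * 'I_n} :=
  [set bc : 'I_n * 'I_n | [&& p < bc.1, bc.2 - bc.1 == k.+1 &
     spans s bc.1 (if asc then bc.1 else bc.2) (if asc then bc.2 else bc.1)]].

Lemma spans_Phi n (s : 'S_n) (p b lo hi : 'I_n) : s p = 0 :> nat ->
  p < b -> p < lo -> p < hi -> spans (Phi s) b lo hi = spans s b hi lo.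
Proof.
move=> sp0 lt_pb lt_plo lt_phi; apply: eq_forallb => r.
case: (leqP b r) => //= le_br; have lt_pr := leq_trans lt_pb le_br.
by rewrite ![Phi s _ <= _]leqNgt !(Phi_suffix sp0) // -!leqNgt andbC.
Qed.

Lemma span_pairs_Phi n asc k (s : 'S_n) (p : 'I_n) : s p = 0 :> nat ->
  span_pairs asc k p (Phi s) = span_pairs (~~ asc) k p s.
Proof.
move=> sp0; apply/setP => -[b c]; rewrite !inE /=.
have [lt_pb|//] := ltnP p b; case: eqP => //= eq_k.
have lt_pc : p < c by lia.
by case: asc; rewrite (spans_Phi sp0).
Qed.

(** * The first letter of an occurrence *)

Definition leftmost_below n (s : 'S_n) (b : 'I_n) (v : nat) (a : 'I_n) : bool :=
  [&& a < b, s a < v & [forall r : 'I_n, (r < a) ==> (v <= s r)]].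

Definition rightmost_below n (s : 'S_n) (b : 'I_n) (v : nat) (a : 'I_n) : bool :=
  [&& a < b, s a < v & [forall r : 'I_n, (a < r < b) ==> (v <= s r)]].

(** What the count of occurrences uses of the rule selecting the first letter:
    it picks exactly one of the entries below [v] to the left of [b], if any. *)
Definition selects_below n (s : 'S_n) (sel : 'I_n -> nat -> 'I_n -> bool) :=
  [/\ forall (b : 'I_n) v a, sel b v a -> a < b /\ s a < v,
      forall b v a a', sel b v a -> sel b v a' -> a = a'
    & forall (b : 'I_n) v (a : 'I_n), a < b -> s a < v -> exists a', sel b v a'].

Lemma leftmost_selects n (s : 'S_n) : selects_below s (leftmost_below s).
Proof.
split=> [b v a /and3P[]//|b v a a'|b v a lt_ab lt_av].
  move=> /and3P[_ lt_av /forallP /(_ a')] Ha /and3P[_ lt_av' /forallP /(_ a)] Ha'.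
  by apply/val_inj => /=; lia.
case: (@arg_minnP _ a (fun i => s i < v) val lt_av) => a' /= lt_a'v a'_min.
exists a'; apply/and3P; split=> //; first by have := a'_min a lt_av; lia.
by apply/forallP => r; apply/implyP => lt_ra'; have := a'_min r; lia.
Qed.

Lemma rightmost_selects n (s : 'S_n) : selects_below s (rightmost_below s).
Proof.
split=> [b v a /and3P[]//|b v a a'|b v a lt_ab lt_av].
  move=> /and3P[lt_ab lt_av /forallP /(_ a')] Ha.
  move=> /and3P[lt_ab' lt_av' /forallP /(_ a)] Ha'.
  by apply/val_inj => /=; lia.
have Pa : (a < b) && (s a < v) by rewrite lt_ab.
case: (@arg_maxnP _ a (fun i => (i < b) && (s i < v)) val Pa).
move=> a' /= /andP[lt_a'b lt_a'v] a'_max.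
exists a'; apply/and3P; split=> //; apply/forallP => r; apply/implyP => a'rb.
by have := a'_max r; lia.
Qed.

(** * Occurrences of the four patterns *)

Definition mesh_asc (asc : bool) (R : seq (nat * nat)) : mesh_pattern 3 :=
  mesh3 (if asc then [:: 1; 2; 3] else [:: 1; 3; 2]) R.

Lemma mesh_asc_perm asc R (x : 'I_3) :
  (mesh_perm (mesh_asc asc R) x).+1 =
    nth 0 (if asc then [:: 1; 2; 3] else [:: 1; 3; 2]) x.
Proof. by rewrite -nth_oneline of_onelineK //; case: asc. Qed.

Lemma forall_ord3 (P : pred 'I_3) :
  [forall x, P x] = [&& P (@Ordinal 3 0 isT), P (@Ordinal 3 1 isT)
                      & P (@Ordinal 3 2 isT)].
Proof.
apply/forallP/and3P => [P_all //|[P0 P1 P2] [[|[|[|//]]] lt_x]];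
  by rewrite (bool_irrelevance lt_x isT).
Qed.

Definition in_cell n (ps vs : seq nat) (s : 'S_n) (r : 'I_n) (ab : nat * nat) :=
  (nth 0 ps ab.1 < r.+1 < nth 0 ps ab.1.+1) &&
  (nth 0 vs ab.2 < (s r).+1 < nth 0 vs ab.2.+1).

Lemma sort3 x y z : x < y -> y < z ->
  (sort leq [:: x; y; z] = [:: x; y; z]) *
  (sort leq [:: x; z; y] = [:: x; y; z]).
Proof.
move=> lt_xy lt_yz; have xyz : sorted leq [:: x; y; z].
  by rewrite /= (ltnW lt_xy) (ltnW lt_yz).
split; first exact: (sorted_sort leq_trans).
apply: (sorted_eq leq_trans anti_leq) => //; first exact: sort_sorted leq_total _.
by rewrite perm_sort perm_cons (perm_catC [:: z] [:: y]).
Qed.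

(** The grid lines of an occurrence, made explicit: since [lo] carries the
    lower of the two last letters, the values come out sorted as those at a,
    [lo] and [hi]. *)
Lemma occurrence_mesh_asc n asc R (s : 'S_n) (a b c : 'I_n) :
  all (fun ab => (ab.1 < 4) && (ab.2 < 4)) R ->
  let lo := if asc then b else c in let hi := if asc then c else b in
  occurrence (mesh_asc asc R) s [tuple a; b; c] =
    [&& a < b, b < c, s a < s lo, s lo < s hi &
     [forall r, all (fun ab => ~~ in_cell [:: 0; a.+1; b.+1; c.+1; n.+1]
       [:: 0; (s a).+1; (s lo).+1; (s hi).+1; n.+1] s r ab) R]].
Proof.
move=> R_bnd lo hi; rewrite /occurrence.
set A1 := [forall x : 'I_3, _]; set A2 := [forall x : 'I_3, _].
set A3 := [forall ab in _, _]; set B := [forall r : 'I_n, _].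
have A1E : A1 = (a < b) && (b < c).
  rewrite /A1 !forall_ord3 !(tnth_nth a) /=.
  case: (ltnP a b) => //= lt_ab; case: (ltnP b c) => lt_bc; last by rewrite andbF.
  by rewrite (ltn_trans lt_ab).
have A2E : A2 = (s a < s lo) && (s lo < s hi).
  (* Passing to successors turns pattern letters into letters of the word. *)
  rewrite /A2 !forall_ord3 -!(ltnS (mesh_perm _ _).+1) !mesh_asc_perm.
  rewrite !(tnth_nth a) /lo /hi; case: (asc) => /=;
    move: (s a : nat) (s b : nat) (s c : nat) => x y z; clear;
    by case: (ltngtP x y); case: (ltngtP x z); case: (ltngtP y z);
      rewrite /= ?ltnn //=; lia.
rewrite A1E A2E -!andbA; do 2 congr (_ && _).
have [lt_alo /=|//] := ltnP (s a) (s lo).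
have [lt_lohi /=|//] := ltnP (s lo) (s hi).
have valE : occ_val s [tuple a; b; c] =
    [:: 0; (s a).+1; (s lo).+1; (s hi).+1; n.+1].
  have := @sort3 (s a).+1 (s lo).+1 (s hi).+1 lt_alo lt_lohi.
  by rewrite /occ_val /bordered /= /lo /hi; case: (asc) => sortE; rewrite sortE.
rewrite /A3 /B valE; apply/forallP/forallP => [avoid r|avoid [x y]].
  apply/allP => -[x y] xyR; have /andP[/= lt_x lt_y] := allP R_bnd _ xyR.
  have := avoid (Ordinal lt_x, Ordinal lt_y); rewrite inE xyR /=.
  by move=> /existsPn /(_ r).
rewrite inE; apply/implyP => xyR; apply/existsPn => r.
exact: (allP (avoid r) _ xyR).
Qed.

Lemma eq_images n (s : 'S_n) (i j : 'I_n) :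
  (s i == s j :> nat) = (i == j :> nat).
Proof. exact: (inj_eq (@perm_inj _ s) i j). Qed.

Lemma spans_lt n asc (s : 'S_n) (b c : 'I_n) :
  let lo := if asc then b else c in let hi := if asc then c else b in
  b < c -> spans s b lo hi -> s lo < s hi.
Proof.
move=> lo hi lt_bc /forallP /(_ b); have := eq_images s b c.
by rewrite /lo /hi; case: (asc); lia.
Qed.

(** The six cells in columns 2 and 3 confine the entries after b, and the cells
    (0, 0) and (0, 1) forbid entries below the level [s lo] before a.  Entries
    on a grid line are those at a, b or c, which is why the strict conditions
    of the cells become the weak ones on the right. *)
Lemma avoids34 n asc (s : 'S_n) (a b c r : 'I_n) :
  let lo := if asc then b else c in let hi := if asc then c else b in
  a < b -> b < c -> s a < s lo -> s lo < s hi ->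
  all (fun ab => ~~ in_cell [:: 0; a.+1; b.+1; c.+1; n.+1]
         [:: 0; (s a).+1; (s lo).+1; (s hi).+1; n.+1] s r ab) shade34 =
  ((b <= r) ==> (s lo <= s r <= s hi)) && ((r < a) ==> (s lo <= s r)).
Proof.
rewrite /in_cell /= !ltnS !andbT.
move: (ltn_ord r) (ltn_ord (s r)).
move: (eq_images s r a) (eq_images s r b) (eq_images s r c).
case: asc; move: (s a : nat) (s b : nat) (s c : nat) (s r : nat) => xa xb xc xr;
  move: (a : nat) (b : nat) (c : nat) (r : nat) => {s}a {}b {}c {}r;
  case: (ltngtP r a); case: (ltngtP r b); case: (ltngtP r c) => /=; lia.
Qed.

(** As before, with the cells (1, 0) and (1, 1) forbidding low entries between
    a and b instead. *)
Lemma avoids78 n asc (s : 'S_n) (a b c r : 'I_n) :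
  let lo := if asc then b else c in let hi := if asc then c else b in
  a < b -> b < c -> s a < s lo -> s lo < s hi ->
  all (fun ab => ~~ in_cell [:: 0; a.+1; b.+1; c.+1; n.+1]
         [:: 0; (s a).+1; (s lo).+1; (s hi).+1; n.+1] s r ab) shade78 =
  ((b <= r) ==> (s lo <= s r <= s hi)) && ((a < r < b) ==> (s lo <= s r)).
Proof.
rewrite /in_cell /= !ltnS !andbT.
move: (ltn_ord r) (ltn_ord (s r)).
move: (eq_images s r a) (eq_images s r b) (eq_images s r c).
case: asc; move: (s a : nat) (s b : nat) (s c : nat) (s r : nat) => xa xb xc xr;
  move: (a : nat) (b : nat) (c : nat) (r : nat) => {s}a {}b {}c {}r;
  case: (ltngtP r a); case: (ltngtP r b); case: (ltngtP r c) => /=; lia.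
Qed.

(** The predicate [gap] stands for the positions whose entries the two shaded
    cells in column 0 or 1 keep above the lower of the two last letters. *)
Lemma occurrence_spans n asc R (s : 'S_n) (a b c : 'I_n) (gap : pred 'I_n) :
  all (fun ab => (ab.1 < 4) && (ab.2 < 4)) R ->
  let lo := if asc then b else c in let hi := if asc then c else b in
  (forall r, a < b -> b < c -> s a < s lo -> s lo < s hi ->
    all (fun ab => ~~ in_cell [:: 0; a.+1; b.+1; c.+1; n.+1]
           [:: 0; (s a).+1; (s lo).+1; (s hi).+1; n.+1] s r ab) R =
    ((b <= r) ==> (s lo <= s r <= s hi)) && (gap r ==> (s lo <= s r))) ->
  occurrence (mesh_asc asc R) s [tuple a; b; c] =
    [&& b < c, spans s b lo hi, a < b, s a < s lo
      & [forall r, gap r ==> (s lo <= s r)]].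
Proof.
move=> R_bnd lo hi avoidE; rewrite occurrence_mesh_asc //.
apply/and5P/and5P => [[lt_ab lt_bc lt_alo lt_lohi /forallP avoid]|].
  by split=> //; apply/forallP => r; have := avoid r; rewrite avoidE // => /andP[].
move=> [lt_bc span lt_ab lt_alo /forallP below].
have lt_lohi := spans_lt lt_bc span.
split=> //; apply/forallP => r; rewrite avoidE // below andbT.
exact: (forallP span r).
Qed.

Lemma occurrence34 n asc (s : 'S_n) (a b c : 'I_n) :
  let lo := if asc then b else c in let hi := if asc then c else b in
  occurrence (mesh_asc asc shade34) s [tuple a; b; c] =
    [&& b < c, spans s b lo hi & leftmost_below s b (s lo) a].
Proof. by apply: occurrence_spans => // r; apply: avoids34. Qed.

Lemma occurrence78 n asc (s : 'S_n) (a b c : 'I_n) :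
  let lo := if asc then b else c in let hi := if asc then c else b in
  occurrence (mesh_asc asc shade78) s [tuple a; b; c] =
    [&& b < c, spans s b lo hi & rightmost_below s b (s lo) a].
Proof. by apply: occurrence_spans => // r; apply: avoids78. Qed.

(** * Counting occurrences by their last two letters *)

(** Forgetting the first letter is injective on occurrences, because [sel]
    determines that letter from the other two.  A spanning pair (b, c) comes
    from an occurrence exactly when some entry to the left of b is below the
    minimum of the suffix; this amounts to b being to the right of the
    position p of the least entry, which would otherwise be that minimum. *)
Lemma refined_stat_spans n asc R sel (s : 'S_n) (p : 'I_n) k :
  s p = 0 :> nat -> selects_below s sel ->
  (forall a b c : 'I_n,
    let lo := if asc then b else c in let hi := if asc then c else b in
    occurrence (mesh_asc asc R) s [tuple a; b; c] =
      [&& b < c, spans s b lo hi & sel b (s lo) a]) ->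
  refined_stat (mesh_asc asc R) k s = #|span_pairs asc k p s|.
Proof.
move=> sp0 [sel_below sel_uniq sel_ex] occE.
rewrite /refined_stat; set T := [set t | _].
pose last2 (t : 3.-tuple 'I_n) :=
  (tnth t (@Ordinal 3 1 isT), tnth t (@Ordinal 3 2 isT)).
have tupE (t : 3.-tuple 'I_n) : exists a b c, t = [tuple a; b; c].
  case: t => [[|a [|b [|c [|//]]]] //= t_size].
  by exists a, b, c; apply/val_inj.
have memT a b c : ([tuple a; b; c] \in T) =
    [&& b < c, spans s b (if asc then b else c) (if asc then c else b),
        sel b (s (if asc then b else c)) a & c - b == k.+1].
  by rewrite inE occE !(tnth_nth a) /= -!andbA.
have last2E a b c : last2 [tuple a; b; c] = (b, c).
  by rewrite /last2 !(tnth_nth a).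
have last2_inj : {in T &, injective last2}.
  move=> t t'; have [a [b [c ->]]] := tupE t; have [a' [b' [c' ->]]] := tupE t'.
  rewrite !memT !last2E => /and4P[_ _ sel_a _] /and4P[_ _ sel_a' _] [eq_b eq_c].
  by move: sel_a'; rewrite -eq_b -eq_c => /(sel_uniq _ _ _ _ sel_a) ->.
rewrite -(card_in_imset last2_inj); apply: eq_card => -[b c].
rewrite inE /=; apply/imsetP/and3P => [[t]|[lt_pb eq_k span]].
  have [a [b' [c' ->]]] := tupE t; rewrite memT last2E.
  move=> /and4P[_ span /sel_below[_ lt_a] eq_k] [-> ->]; split=> //.
  rewrite ltnNge; apply/negP => le_bp.
  by have /forallP/(_ p) := span; rewrite le_bp sp0; lia.
have lt_bc : b < c by lia.
set lo := if asc then b else c in span.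
have lt_plo : s p < s lo.
  rewrite sp0 lt0n; apply: contraTneq lt_pb => slo0.
  have -> : p = lo by apply/(perm_inj (s := s))/val_inj; rewrite /= sp0 slo0.
  by rewrite /lo; case: (asc); rewrite -leqNgt ?leqnn ?(ltnW lt_bc).
(* The entry 1 itself is a candidate, so some first letter exists. *)
have [a sel_a] := sel_ex b _ p lt_pb lt_plo.
by exists [tuple a; b; c]; rewrite ?last2E // memT lt_bc span sel_a.
Qed.

Lemma vector_stat_Phi n asc R (sel : 'S_n -> 'I_n -> nat -> 'I_n -> bool)
    (s : 'S_n) (p : 'I_n) :
  s p = 0 :> nat -> (forall s, selects_below s (sel s)) ->
  (forall asc s (a b c : 'I_n),
    let lo := if asc then b else c in let hi := if asc then c else b in
    occurrence (mesh_asc asc R) s [tuple a; b; c] =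
      [&& b < c, spans s b lo hi & sel s b (s lo) a]) ->
  vector_stat (mesh_asc asc R) s = vector_stat (mesh_asc (~~ asc) R) (Phi s).
Proof.
move=> sp0 selP occE; apply: eq_map => k.
have Phip0 : Phi s p = 0 :> nat by rewrite (Phi_prefix sp0).
rewrite (refined_stat_spans k sp0 (selP s) (occE asc s)).
rewrite (refined_stat_spans k Phip0 (selP _) (occE (~~ asc) _)).
by rewrite span_pairs_Phi // negbK.
Qed.

Theorem theorem2p5 (n : nat) (n_ge1 : 1 <= n) (s : 'S_n) :
  (lrmin s, vector_stat P3 s, vector_stat P4 s,
   vector_stat P7 s, vector_stat P8 s) =
  (lrmin (Phi s), vector_stat P4 (Phi s), vector_stat P3 (Phi s),
   vector_stat P8 (Phi s), vector_stat P7 (Phi s)).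
Proof.
pose p := (s^-1)%g (Ordinal n_ge1).
have sp0 : s p = 0 :> nat by rewrite permKV.
have stat34 asc : vector_stat (mesh_asc asc shade34) s =
    vector_stat (mesh_asc (~~ asc) shade34) (Phi s).
  exact: (@vector_stat_Phi n asc _ _ s p sp0 (@leftmost_selects n)
    (@occurrence34 n)).
have stat78 asc : vector_stat (mesh_asc asc shade78) s =
    vector_stat (mesh_asc (~~ asc) shade78) (Phi s).
  exact: (@vector_stat_Phi n asc _ _ s p sp0 (@rightmost_selects n)
    (@occurrence78 n)).
rewrite (lrmin_Phi sp0).
by rewrite (stat34 true) (stat34 false) (stat78 true) (stat78 false).
Qed.
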